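(* Let $m\le n$, let $Y\in\mathbb{R}^{m\times n}$ have singular values $\sigma_{Y,1}\ge\sigma_{Y,2}\ge\cdots\ge\sigma_{Y,m}\ge 0$, and for $\lambda\ge 0$ let $\widehat{X}(\lambda)=\operatorname{SVT}_\lambda(Y)$ be the matrix obtained by applying the singular value thresholding operator to $Y$ (for $\lambda>0$ this is the solution of $\min_{X\in\mathbb{R}^{m\times n}}\|X\|_*+\frac{1}{2\lambda}\|X-Y\|_F^2$). Then the function $\lambda\mapsto\|Y-\widehat{X}(\lambda)\|_F^2$ is strictly increasing on the interval $[0,\sigma_{Y,1}]$ and positive on $(0,\sigma_{Y,1}]$.
   Context: $\|\cdot\|_F$ is the Frobenius norm and $\|X\|_*$ is the nuclear norm (sum of the singular values of $X$). Write a singular value decomposition $Y=\sum_{i=1}^m\sigma_{Y,i}\mathbf{u}_i\mathbf{v}_i^T$ with orthonormal left singular vectors $\mathbf{u}_i\in\mathbb{R}^m$ and orthonormal right singular vectors $\mathbf{v}_i\in\mathbb{R}^n$. With $(x)_+=\max(x,0)$, the singular value thresholding operator is $\operatorname{SVT}_\lambda(Y)=\sum_{i=1}^m(\sigma_{Y,i}-\lambda)_+\mathbf{u}_i\mathbf{v}_i^T$. *)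

(* Defs.v *)
From mathcomp Require Import all_boot all_order all_algebra.
From mathcomp Require Import boolp classical_sets reals.

Set Implicit Arguments.
Unset Strict Implicit.
Unset Printing Implicit Defensive.

Import Order.TTheory GRing.Theory Num.Theory.

Local Open Scope ring_scope.

Definition frobenius_norm (R : realType) (m n : nat) (A : 'M[R]_(m, n)) : R :=
  Num.sqrt (\sum_(i < m) \sum_(j < n) A i j ^+ 2).

(* A sum of m rank-one terms; u_i and v_i are the i-th columns of U and V. *)
Definition dyad_sum (R : realType) (m n : nat)
    (s : 'I_m -> R) (U : 'M[R]_m) (V : 'M[R]_(n, m)) : 'M[R]_(m, n) :=
  \sum_(i < m) s i *: (col i U *m (col i V)^T).

(* Thin singular value decomposition of an m x n matrix with m <= n: there are
   m singular values, the zero ones included.  Since V has m orthonormal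
   columns in R^n, no such decomposition exists when n < m. *)
Definition is_svd (R : realType) (m n : nat) (A : 'M[R]_(m, n))
    (s : 'I_m -> R) (U : 'M[R]_m) (V : 'M[R]_(n, m)) : Prop :=
  [/\ U^T *m U = 1%:M,
      V^T *m V = 1%:M,
      forall i : 'I_m, 0 <= s i,
      forall i j : 'I_m, (i <= j)%N -> s j <= s i
    & A = dyad_sum s U V].

Definition singular_values (R : realType) (m n : nat) (A : 'M[R]_(m, n))
    (s : 'I_m -> R) : Prop :=
  exists (U : 'M[R]_m) (V : 'M[R]_(n, m)), is_svd A s U V.

(* For m <= n the set below has exactly one element, and so has the one in SVT
   when moreover 0 <= lambda: the value does not depend on the decomposition.
   The default 0 is only reached when n < m. *)
Definition nuclear_norm (R : realType) (m n : nat) (A : 'M[R]_(m, n)) : R :=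
  xget 0 [set x : R | exists s : 'I_m -> R,
                        singular_values A s /\ x = \sum_(i < m) s i]%classic.

Definition SVT (R : realType) (m n : nat) (lambda : R) (A : 'M[R]_(m, n)) :
    'M[R]_(m, n) :=
  xget 0 [set X : 'M[R]_(m, n) |
           exists (s : 'I_m -> R) (U : 'M[R]_m) (V : 'M[R]_(n, m)),
             is_svd A s U V /\
             X = dyad_sum (fun i => Num.max (s i - lambda) 0) U V]%classic.

Definition svt_objective (R : realType) (m n : nat) (lambda : R)
    (Y X : 'M[R]_(m, n)) : R :=
  nuclear_norm X + (2 * lambda)^-1 * frobenius_norm (X - Y) ^+ 2.

Definition is_minimizer (R : realType) (T : Type) (f : T -> R) (x : T) : Prop :=
  forall y : T, f x <= f y.

(* Main.v *)
(* Every X with m <= n has a singular value decomposition (repeatedly split off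
   a singular pair with Householder reflections, then sort), and pairing X with
   matrices W of spectral norm at most 1 gives tr(W^T X) <= |X|_*, so that |X|_*
   is the sum of the singular values in any decomposition.  For X0 the
   thresholding of any decomposition of Y, W = (Y - X0) / lambda has spectral
   norm at most 1 and tr(W^T X0) = |X0|_*, so expanding the square yields
     objective(X) >= objective(X0) + |X - X0|_F^2 / (2 lambda).
   Hence X0 is the unique minimizer and does not depend on the decomposition;
   the residual is then the sum of min(sigma_i, lambda)^2, whose first term is
   strictly increasing on [0, sigma_1]. *)
Require Import Defs.
From mathcomp Require Import all_boot all_order all_algebra.
From mathcomp Require Import boolp classical_sets reals.
From mathcomp Require Import all_fingroup complex spectral ring lra.

Set Implicit Arguments.
Unset Strict Implicit.
Unset Printing Implicit Defensive.

Import Order.TTheory GRing.Theory Num.Theory.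

Local Open Scope ring_scope.

(** * The Frobenius inner product in trace form *)

Lemma mxtrace_sqr (R : comPzRingType) (m n : nat) (A : 'M[R]_(m, n)) :
  \tr (A^T *m A) = \sum_(i < m) \sum_(j < n) A i j ^+ 2.
Proof.
rewrite exchange_big; apply: eq_bigr => j _; rewrite mxE.
by apply: eq_bigr => i _; rewrite mxE expr2.
Qed.

Lemma mxtrace_sqr_ge0 (R : realDomainType) (m n : nat) (A : 'M[R]_(m, n)) :
  0 <= \tr (A^T *m A).
Proof. by rewrite mxtrace_sqr; do 2![apply: sumr_ge0 => ? _]; rewrite sqr_ge0. Qed.

Lemma mxtrace_sqr_eq0 (R : realDomainType) (m n : nat) (A : 'M[R]_(m, n)) :
  (\tr (A^T *m A) == 0) = (A == 0).
Proof.
rewrite mxtrace_sqr; apply/idP/eqP => [|->]; last first.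
  by rewrite big1 // => i _; rewrite big1 // => j _; rewrite mxE expr0n.
rewrite psumr_eq0 => [/allP A0|i _]; last by apply: sumr_ge0 => j _; exact: sqr_ge0.
apply/matrixP => i j; have := A0 i (mem_index_enum i).
rewrite psumr_eq0 => [/allP/(_ j (mem_index_enum j))|k _]; last exact: sqr_ge0.
by rewrite /= sqrf_eq0 mxE => /eqP.
Qed.

Lemma mxtrace_mulC_tr (R : comPzRingType) (m n : nat) (A B : 'M[R]_(m, n)) :
  \tr (A^T *m B) = \tr (B^T *m A).
Proof. by rewrite -mxtrace_tr trmx_mul trmxK. Qed.

(** * Existence of a singular value decomposition, without ordering *)

Lemma cvec_sqrE (R : comPzRingType) (n : nat) (w : 'cV[R]_n) :
  w^T *m w = (\tr (w^T *m w))%:M.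
Proof. by rewrite {1}[w^T *m w]mx11_scalar /mxtrace big_ord1. Qed.

Lemma normalize_cvec (R : rcfType) (n : nat) (w : 'cV[R]_n) :
  w != 0 -> exists c : R, (c *: w)^T *m (c *: w) = 1%:M.
Proof.
move=> w0; have := cvec_sqrE w; set t := \tr _ => wE; exists (Num.sqrt t)^-1.
have t0 : 0 < t by rewrite lt_neqAle eq_sym mxtrace_sqr_eq0 w0 mxtrace_sqr_ge0.
rewrite [(_ *: _)^T]linearZ /= -scalemxAl -scalemxAr scalerA wE scale_scalar_mx.
by rewrite -invfM -expr2 sqr_sqrtr ?ltW // mulVf // gt_eqF.
Qed.

(* The complex matrix M has an eigenvector p + i q; symmetry forces its
   eigenvalue to be real, hence p or q is a real eigenvector. *)
Lemma symmetric_eigenvector (R : rcfType) (n : nat) (M : 'M[R]_n) :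
  (0 < n)%N -> M^T = M ->
  exists (w : 'cV[R]_n) (a : R), w != 0 /\ M *m w = a *: w.
Proof.
move=> n_gt0 symM.
have [a /eigenvalueP[x /matrixP xM x0]] :=
  eigenvalue_closed (map_mx (real_complex R) M) n_gt0.
pose p := map_mx (@complex.Re R) x; pose q := map_mx (@complex.Im R) x.
have pq0 : (p != 0) || (q != 0).
  rewrite -negb_and; apply: contra x0 => /andP[/eqP/matrixP p0 /eqP/matrixP q0].
  apply/eqP/matrixP => i j; have := p0 i j; have := q0 i j; rewrite !mxE.
  by case: (x i j) => b c /= -> ->.
have ReS (F : 'I_n -> R[i]) : complex.Re (\sum_i F i) = \sum_i complex.Re (F i).
  by apply: (big_morph (@complex.Re R)) => // -[? ?] [? ?].
have ImS (F : 'I_n -> R[i]) : complex.Im (\sum_i F i) = \sum_i complex.Im (F i).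
  by apply: (big_morph (@complex.Im R)) => // -[? ?] [? ?].
have pM : p *m M = complex.Re a *: p - complex.Im a *: q.
  apply/matrixP => i j; have /(congr1 (@complex.Re R)) := xM i j.
  rewrite !mxE ReS; under eq_bigr => k _ do rewrite !mxE.
  case: (a) (x i j) => [b c] [d e] /= <-; apply: eq_bigr => k _; rewrite !mxE.
  by case: (x i k) => ? ? /=; rewrite mulr0 subr0.
have qM : q *m M = complex.Re a *: q + complex.Im a *: p.
  apply/matrixP => i j; have /(congr1 (@complex.Im R)) := xM i j.
  rewrite !mxE ImS; under eq_bigr => k _ do rewrite !mxE.
  case: (a) (x i j) => [b c] [d e] /= <-; apply: eq_bigr => k _; rewrite !mxE.
  by case: (x i k) => ? ? /=; rewrite mulr0 add0r.
(* Expanding both sides by [pM] and [qM], the terms in [complex.Re a] cancel and leave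
   [complex.Im a * (|p|^2 + |q|^2) = 0]. *)
have pMq : \tr (p *m M *m q^T) = \tr (q *m M *m p^T).
  by rewrite -mxtrace_tr !trmx_mul trmxK symM mulmxA.
have Ima0 : complex.Im a = 0.
  move: pMq; rewrite pM qM mulmxBl mulmxDl !linearD !linearN /= -!scalemxAl !linearZ /=.
  have -> : \tr (p *m q^T) = \tr (q *m p^T) by rewrite -mxtrace_tr trmx_mul trmxK.
  move=> /addrI /eqP; rewrite eq_sym -subr_eq0 opprK -mulrDr mulf_eq0 => /orP[/eqP//|].
  have sqrE (r : 'rV_n) : \tr (r *m r^T) = \tr (r^T^T *m r^T) by rewrite trmxK.
  rewrite !sqrE paddr_eq0 ?mxtrace_sqr_ge0 //.
  by rewrite !mxtrace_sqr_eq0 !trmx_eq0 -[_ && _]negbK negb_and pq0.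
move: pM qM; rewrite Ima0 !scale0r subr0 addr0 => pM qM.
have eigen (r : 'rV_n) : r *m M = complex.Re a *: r -> M *m r^T = complex.Re a *: r^T.
  by move=> rM; rewrite -{1}symM -trmx_mul rM linearZ.
by case/orP: pq0 => r0; [exists p^T | exists q^T]; exists (complex.Re a);
  rewrite trmx_eq0; split=> //; exact: eigen.
Qed.

(* H is the reflection that exchanges w and the first basis vector. *)
Lemma householder (R : rcfType) (n : nat) (w : 'cV[R]_(1 + n)) :
  w^T *m w = 1%:M ->
  exists H : 'M[R]_(1 + n), H^T *m H = 1%:M /\ H *m col_mx 1%:M 0 = w.
Proof.
set e := col_mx 1%:M 0 => w1.
have e1 : e^T *m e = 1%:M by rewrite tr_col_mx mul_row_col trmx1 mulmx1 mulmx0 addr0.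
(* For [w = e] the normal [w - e] of the mirror vanishes, so the identity is taken instead. *)
have [->|we] := eqVneq w e; first by exists 1%:M; rewrite trmx1 mulmx1 mul1mx.
pose z := w - e; pose t := \tr (z^T *m z); pose d := \tr (w^T *m e).
have t0 : t != 0 by rewrite mxtrace_sqr_eq0 subr_eq0.
have weE : w^T *m e = d%:M by rewrite [LHS]mx11_scalar /d /mxtrace big_ord1.
have ewE : e^T *m w = d%:M by rewrite -[LHS]trmxK trmx_mul trmxK weE tr_scalar_mx.
have tE : t = 2 - 2 * d.
  rewrite /t /z [(_ - _)^T]linearB /= mulmxBl !mulmxBr w1 e1 weE ewE !raddfB /=.
  rewrite !mxtrace_scalar; ring.
have zz : z^T *m z = t%:M by exact: cvec_sqrE.
have ze : z^T *m e = (d - 1)%:M by rewrite /z [(_ - _)^T]linearB /= mulmxBl weE e1 raddfB.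
exists (1%:M - (2 / t) *: (z *m z^T)); split.
  rewrite [(_ - _)^T]linearB /= trmx1 [(_ *: _)^T]linearZ /= trmx_mul trmxK.
  rewrite mulmxBl mul1mx mulmxBr mulmx1 -scalemxAl -scalemxAr mulmxA -(mulmxA z) zz mul_mx_scalar -scalemxAl !scalerA.
  rewrite -scalerBl -addrA -opprD -scalerDl.
  set c := (X in X *: _); suff -> : c = 0 by rewrite scale0r subr0.
  by rewrite /c; field.
rewrite mulmxBl mul1mx -scalemxAl -mulmxA ze mul_mx_scalar scalerA.
suff -> : 2 / t * (d - 1) = -1 by rewrite scaleN1r opprK /z addrC subrK.
by move: t0; rewrite tE => t0; field.
Qed.

(** A unit eigenvector [u] of [A *m A^T] determines the pair: [v] is [A^T *m u] divided by its
    length [s], and the eigenvalue is [s ^+ 2]. If [A^T *m u] vanishes, any unit vector in the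
    kernel of [A] serves as [v], with [s = 0]. *)
Lemma singular_pair (R : rcfType) (m n : nat) (A : 'M[R]_(m.+1, n.+1)) :
  (m <= n)%N ->
  exists (s : R) (u : 'cV[R]_m.+1) (v : 'cV[R]_n.+1),
    [/\ 0 <= s, u^T *m u = 1%:M, v^T *m v = 1%:M, A *m v = s *: u & A^T *m u = s *: v].
Proof.
move=> le_mn.
have [|w [a [w0 wE]]] := @symmetric_eigenvector _ _ (A *m A^T) (ltn0Sn m).
  by rewrite trmx_mul trmxK.
have [c] := normalize_cvec w0; set u := c *: w => u1.
have uE : A *m (A^T *m u) = a *: u.
  by rewrite mulmxA /u -scalemxAr wE !scalerA mulrC.
have [Au0|Au0] := eqVneq (A^T *m u) 0.
  (* The row rank of A is at most m < n.+1, so A has a nonzero kernel vector. *)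
  have : kermx A^T != 0.
    rewrite -mxrank_eq0 mxrank_ker mxrank_tr subn_eq0 -ltnNge.
    have kerA : (u^T <= kermx A)%MS.
      by apply/sub_kermxP; rewrite -[A]trmxK -trmx_mul Au0 trmx0.
    have : (0 < \rank (kermx A))%N.
      rewrite lt0n mxrank_eq0; apply: contraTneq kerA => ->.
      rewrite submx0 trmx_eq0; apply: contra_eqN u1 => /eqP ->.
      by rewrite mulmx0 eq_sym oner_eq0.
    by rewrite mxrank_ker subn_gt0 => /leq_trans; apply.
  case/rowV0Pn => r /sub_kermxP rA r0.
  have rT0 : r^T != 0 by rewrite trmx_eq0.
  have [k v1] := normalize_cvec rT0.
  exists 0, u, (k *: r^T); split => //; last by rewrite Au0 scale0r.
  by rewrite -scalemxAr -[A]trmxK -trmx_mul rA trmx0 scaler0 scale0r.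
pose s := Num.sqrt (\tr ((A^T *m u)^T *m (A^T *m u))).
have s2 : s ^+ 2 = \tr ((A^T *m u)^T *m (A^T *m u)) by rewrite sqr_sqrtr ?mxtrace_sqr_ge0.
have s0 : s != 0 by rewrite -sqrf_eq0 s2 mxtrace_sqr_eq0.
have as2 : a = s ^+ 2.
  rewrite s2 trmx_mul trmxK -mulmxA uE -scalemxAr u1 scale_scalar_mx mulr1.
  by rewrite mxtrace_scalar.
exists s, u, (s^-1 *: (A^T *m u)); split => //.
- exact: sqrtr_ge0.
- rewrite [(_ *: _)^T]linearZ /= -scalemxAl -scalemxAr scalerA cvec_sqrE -s2 scale_scalar_mx.
  by congr (_%:M); field.
- by rewrite -scalemxAr uE scalerA as2; congr (_ *: _); field.
- by rewrite scalerA divff // scale1r.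
Qed.

(** Induction on [m] for all [n]: orthogonal [H] and [K] taking the first basis vectors to a
    singular pair make [H^T *m A *m K] block diagonal with corner [s], and the induction hypothesis
    decomposes the other block. The pair is arbitrary, so the values come in no particular order. *)
Lemma unsorted_svd (R : rcfType) (m n : nat) (A : 'M[R]_(m, n)) : (m <= n)%N ->
  exists (s : 'rV[R]_m) (U : 'M[R]_m) (V : 'M[R]_(n, m)),
    [/\ U^T *m U = 1%:M, V^T *m V = 1%:M, forall i, 0 <= s 0 i
      & A = U *m diag_mx s *m V^T].
Proof.
elim: m n A => [|m IHm] [|n] A // le_mn.
- exists 0, 1%:M, 0; split; [| | case => // |]; apply/matrixP; case => //.
- exists 0, 1%:M, 0; split; [| | case => // |]; apply/matrixP; case => //.
have [s [u [v [s0 u1 v1 Av Au]]]] := singular_pair A le_mn.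
have [H [H1 Hu]] := @householder _ m u u1.
have [K [K1 Kv]] := @householder _ n v v1.
have H2 : H *m H^T = 1%:M by exact: mulmx1C.
have K2 : K *m K^T = 1%:M by exact: mulmx1C.
have Hu' : H^T *m u = col_mx 1%:M 0 by rewrite -Hu mulmxA H1 mul1mx.
have Kv' : K^T *m v = col_mx 1%:M 0 by rewrite -Kv mulmxA K1 mul1mx.
pose B : 'M_(1 + m, 1 + n) := H^T *m A *m K.
(* [A *m v = s *: u] fixes the first column of [B], and [A^T *m u = s *: v] its first row. *)
have BE : B = block_mx s%:M 0 0 (drsubmx B).
  have Be : B *m col_mx 1%:M 0 = s *: col_mx 1%:M 0.
    by rewrite /B -!mulmxA Kv Av -scalemxAr Hu'.
  have Bte : B^T *m col_mx 1%:M 0 = s *: col_mx 1%:M 0.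
    by rewrite /B !trmx_mul trmxK -!mulmxA Hu Au -scalemxAr Kv'.
  move: Be; rewrite -{1}[B]submxK mul_block_col !mulmx1 !mulmx0 !addr0.
  rewrite scale_col_mx scaler0 scale_scalar_mx mulr1 => /eq_col_mx[Bul Bdl].
  move: Bte; rewrite -{1}[B]submxK tr_block_mx mul_block_col !mulmx1 !mulmx0 !addr0.
  rewrite scale_col_mx scaler0 => /eq_col_mx[_ Bur].
  by rewrite -{1}[B]submxK Bul Bdl -[ursubmx B]trmxK Bur trmx0.
have [s' [U [V [U1 V1 s'0 DE]]]] := IHm n (drsubmx B) le_mn.
(* The same goal with the sizes read as [1 + m] and [1 + n], as the block matrices require. *)
suff : exists (s : 'rV_(1 + m)) (U : 'M_(1 + m)) (V : 'M_(1 + n, 1 + m)),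
    [/\ U^T *m U = 1%:M, V^T *m V = 1%:M, forall i, 0 <= s 0 i
      & A = U *m diag_mx s *m V^T] by [].
exists (row_mx s%:M s'), (H *m block_mx 1%:M 0 0 U),
  (K *m block_mx 1%:M 0 0 V); split.
- rewrite trmx_mul mulmxA -[_ *m H^T *m H]mulmxA H1 mulmx1 tr_block_mx mulmx_block.
  by rewrite !trmx0 trmx1 !mulmx0 !mul0mx mulmx1 U1 !addr0 add0r -scalar_mx_block.
- rewrite trmx_mul mulmxA -[_ *m K^T *m K]mulmxA K1 mulmx1 tr_block_mx mulmx_block.
  by rewrite !trmx0 trmx1 !mulmx0 !mul0mx mulmx1 V1 !addr0 add0r -scalar_mx_block.
- move=> i; rewrite (row_mxEl, mxE); case: splitP => j _ //.
  by rewrite mxE ord1 eqxx.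
- have -> : A = H *m B *m K^T.
    by rewrite /B -!mulmxA K2 mulmx1 mulmxA H2 mul1mx.
  rewrite {}BE DE diag_mx_row trmx_mul tr_block_mx !trmx0 trmx1 !mulmxA; congr (_ *m _).
  rewrite -!mulmxA; congr (_ *m _).
  rewrite !mulmx_block !mul0mx !mulmx0 !mulmx1 !mul1mx !addr0 !add0r mulmx0 mulmxA.
  by congr block_mx; apply/matrixP => i j; rewrite !ord1 !mxE.
Qed.

(** * Sorted decompositions and sums of dyads *)

Lemma perm_sorting (R : realDomainType) (m : nat) (s : 'I_m -> R) :
  exists p : 'S_m, forall i j : 'I_m, (i <= j)%N -> s (p j) <= s (p i).
Proof.
pose t := [tuple s i | i < m]; pose geR := [rel x y : R | y <= x].
have geR_trans : transitive geR by move=> y x z /= xy yz; exact: le_trans yz xy.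
have [p tE] : exists p : 'S_m, path.sort geR t = [tuple tnth t (p i) | i < m].
  by apply/tuple_permP; rewrite perm_sort.
exists p => i j le_ij; have := sort_sorted (fun x y : R => le_total y x) t.
move/(sorted_leq_nth geR_trans (@lexx _ R) 0)/(_ i j).
rewrite tE !inE size_tuple !ltn_ord => /(_ isT isT le_ij).
by rewrite !nth_mktuple !tnth_mktuple; apply.
Qed.

Lemma dyad_sumE (R : realType) (m n : nat) (s : 'I_m -> R)
    (U : 'M[R]_m) (V : 'M[R]_(n, m)) :
  dyad_sum s U V = U *m diag_mx (\row_i s i) *m V^T.
Proof.
apply/matrixP => i j; rewrite summxE mxE; apply: eq_bigr => k _.
by rewrite mul_mx_diag !mxE big_ord1 !mxE mulrA [s k * _]mulrC.
Qed.

Lemma dyad_sumB (R : realType) (m n : nat) (s t : 'I_m -> R)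
    (U : 'M[R]_m) (V : 'M[R]_(n, m)) :
  dyad_sum s U V - dyad_sum t U V = dyad_sum (fun i => s i - t i) U V.
Proof. by rewrite -sumrB; apply: eq_bigr => i _; rewrite scalerBl. Qed.

Lemma dyad_sumZ (R : realType) (m n : nat) (c : R) (s : 'I_m -> R)
    (U : 'M[R]_m) (V : 'M[R]_(n, m)) :
  c *: dyad_sum s U V = dyad_sum (fun i => c * s i) U V.
Proof. by rewrite scaler_sumr; apply: eq_bigr => i _; rewrite scalerA. Qed.

Lemma eq_dyad_sum (R : realType) (m n : nat) (s t : 'I_m -> R)
    (U : 'M[R]_m) (V : 'M[R]_(n, m)) :
  s =1 t -> dyad_sum s U V = dyad_sum t U V.
Proof. by move=> st; apply: eq_bigr => i _; rewrite st. Qed.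

Lemma col_perm_orthonormal (R : comPzRingType) (m n : nat) (p : 'S_m) (V : 'M[R]_(n, m)) :
  V^T *m V = 1%:M -> (col_perm p V)^T *m col_perm p V = 1%:M.
Proof.
move=> V1; apply/matrixP => i j; have /matrixP/(_ (p i) (p j)) := V1.
by rewrite !mxE (inj_eq perm_inj) => <-; apply: eq_bigr => k _; rewrite !mxE.
Qed.

Lemma svd_exists (R : realType) (m n : nat) (A : 'M[R]_(m, n)) :
  (m <= n)%N -> exists s, singular_values A s.
Proof.
move=> le_mn; have [s [U [V [U1 V1 s0 AE]]]] := unsorted_svd A le_mn.
have [p sp] := perm_sorting (s 0).
exists (fun i => s 0 (p i)), (col_perm p U), (col_perm p V).
split=> //; try exact: col_perm_orthonormal.
have -> : A = dyad_sum (s 0) U V.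
  by rewrite dyad_sumE AE; congr (_ *m diag_mx _ *m _); apply/rowP => i; rewrite mxE.
rewrite /dyad_sum (reindex_inj (@perm_inj _ p)); apply: eq_bigr => i _.
by congr (_ *: (_ *m _^T)); apply/colP => k; rewrite !mxE.
Qed.

(** * Trace duality and the nuclear norm *)

(** [C] is the component of [V1] orthogonal to the columns of [V2]; one minus the sum is the squared
    length of its [i]-th column. *)
Lemma bessel (R : realDomainType) (m1 m2 n : nat)
    (V1 : 'M[R]_(n, m1)) (V2 : 'M[R]_(n, m2)) (i : 'I_m1) :
  V1^T *m V1 = 1%:M -> V2^T *m V2 = 1%:M ->
  \sum_j (V1^T *m V2) i j ^+ 2 <= 1.
Proof.
move=> V1E V2E; pose C := V1 - V2 *m (V2^T *m V1).
have CE : C^T *m C = 1%:M - V1^T *m V2 *m (V1^T *m V2)^T.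
  rewrite /C [(_ - _)^T]linearB /= mulmxBl !mulmxBr V1E !trmx_mul !trmxK !mulmxA.
  by rewrite -[_ *m V2^T *m V2]mulmxA V2E mulmx1 subrr subr0.
have -> : \sum_j (V1^T *m V2) i j ^+ 2 = 1 - (C^T *m C) i i.
  have -> : (C^T *m C) i i = 1 - (V1^T *m V2 *m (V1^T *m V2)^T) i i.
    by rewrite CE !mxE eqxx.
  by rewrite subKr mxE; apply: eq_bigr => j _; rewrite [_^T _ _]mxE expr2.
by rewrite gerBl mxE; apply: sumr_ge0 => k _; rewrite mxE -expr2 sqr_ge0.
Qed.

Lemma mxtrace_dyad_sum (R : realType) (m n : nat) (W : 'M[R]_(m, n)) (s : 'I_m -> R)
    (U : 'M[R]_m) (V : 'M[R]_(n, m)) :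
  \tr (W^T *m dyad_sum s U V) = \sum_i s i * (U^T *m W *m V) i i.
Proof.
rewrite dyad_sumE !mulmxA mxtrace_mulC !mulmxA.
have -> : V^T *m W^T *m U = (U^T *m W *m V)^T by rewrite !trmx_mul trmxK mulmxA.
by apply: eq_bigr => i _; rewrite mul_mx_diag mxE [_^T _ _]mxE mulrC [(\row_ _ _) _ _]mxE.
Qed.

Lemma mxtrace_dyad_sum2 (R : realType) (m n : nat) (s t : 'I_m -> R)
    (U : 'M[R]_m) (V : 'M[R]_(n, m)) :
  U^T *m U = 1%:M -> V^T *m V = 1%:M ->
  \tr ((dyad_sum t U V)^T *m dyad_sum s U V) = \sum_i s i * t i.
Proof.
move=> U1 V1; rewrite mxtrace_dyad_sum; apply: eq_bigr => i _.
rewrite dyad_sumE !mulmxA U1 mul1mx -mulmxA V1 mulmx1.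
by rewrite !mxE eqxx.
Qed.

(* Each u_i^T W v_i is at most 1, by [2 t x y <= x ^+ 2 + y ^+ 2] for
   0 <= t <= 1 and Bessel's inequality. *)
Lemma trace_duality (R : realType) (m n : nat) (s t : 'I_m -> R)
    (U U' : 'M[R]_m) (V V' : 'M[R]_(n, m)) :
  U^T *m U = 1%:M -> V^T *m V = 1%:M -> U'^T *m U' = 1%:M -> V'^T *m V' = 1%:M ->
  (forall i, 0 <= s i) -> (forall i, 0 <= t i <= 1) ->
  \tr ((dyad_sum t U' V')^T *m dyad_sum s U V) <= \sum_i s i.
Proof.
move=> U1 V1 U'1 V'1 s0 t01; rewrite mxtrace_dyad_sum; apply: ler_sum => i _.
apply: ler_piMr => //; rewrite dyad_sumE.
have -> : U^T *m (U' *m diag_mx (\row_i0 t i0) *m V'^T) *m V =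
    (U^T *m U') *m diag_mx (\row_i0 t i0) *m (V^T *m V')^T.
  by rewrite trmx_mul trmxK !mulmxA.
set P := U^T *m U'; set Q := V^T *m V'.
have PQ := lerD (bessel i U1 U'1) (bessel i V1 V'1).
rewrite mxE -(ler_pM2l (ltr0Sn R 1)); apply: le_trans (_ : _ <= 1 + 1) _; last by lra.
apply: le_trans PQ; rewrite mulr_sumr -big_split; apply: ler_sum => j _.
rewrite mul_mx_diag mxE [(\row_ _ _) _ _]mxE [Q^T _ _]mxE /=.
have /andP[t0 t1] := t01 j; rewrite -subr_ge0 in t1.
rewrite -subr_ge0; set p := P i j; set q := Q i j.
have -> : p ^+ 2 + q ^+ 2 - 2 * (p * t j * q) =
    t j * (p - q) ^+ 2 + (1 - t j) * (p ^+ 2 + q ^+ 2) by ring.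
by rewrite addr_ge0 // mulr_ge0 // ?addr_ge0 ?sqr_ge0.
Qed.

(** Two decompositions of [A] have equal sums: pairing [A] with the all-ones dyad sum of one of them
    gives its own sum, which [trace_duality] bounds by the sum of the other. *)
Lemma nuclear_normE (R : realType) (m n : nat) (A : 'M[R]_(m, n)) (s : 'I_m -> R) :
  singular_values A s -> nuclear_norm A = \sum_i s i.
Proof.
move=> As; rewrite /nuclear_norm; case: xgetP => [x _|none]; last first.
  by case: (none (\sum_i s i)); exists s.
have le (r r' : 'I_m -> R) :
    singular_values A r -> singular_values A r' -> \sum_i r' i <= \sum_i r i.
  case=> [U [V [U1 V1 r0 _ AE]]] [U' [V' [U'1 V'1 _ _ AE']]].
  have := @trace_duality _ _ _ r (fun=> 1) U U' V V' U1 V1 U'1 V'1 r0.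
  rewrite -AE AE' mxtrace_dyad_sum2 //; under eq_bigr do rewrite mulr1.
  by apply=> i; rewrite ler01 lexx.
by case=> r [Ar ->]; apply/le_anti; rewrite !le.
Qed.

(** * Optimality of the thresholded matrix *)

Lemma frobenius_norm_sqr (R : realType) (m n : nat) (A : 'M[R]_(m, n)) :
  frobenius_norm A ^+ 2 = \tr (A^T *m A).
Proof.
rewrite mxtrace_sqr sqr_sqrtr //.
by do 2![apply: sumr_ge0 => ? _]; rewrite sqr_ge0.
Qed.

Lemma mxtrace_sqrD (R : comPzRingType) (m n : nat) (A B : 'M[R]_(m, n)) :
  \tr ((A + B)^T *m (A + B)) = \tr (A^T *m A) + 2 * \tr (A^T *m B) + \tr (B^T *m B).
Proof.
rewrite [(_ + _)^T]linearD /= mulmxDl !mulmxDr !raddfD /= (mxtrace_mulC_tr B A).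
by ring.
Qed.

(* With X0 the thresholded matrix, W = (Y - X0) / lambda is a subgradient of
   the nuclear norm at X0. *)
Lemma svt_objective_ge (R : realType) (m n : nat) (lambda : R) (Y X : 'M[R]_(m, n))
    (s : 'I_m -> R) (U : 'M[R]_m) (V : 'M[R]_(n, m)) :
  (m <= n)%N -> 0 < lambda -> is_svd Y s U V ->
  svt_objective lambda Y (dyad_sum (fun i => Num.max (s i - lambda) 0) U V) +
    (2 * lambda)^-1 *
      frobenius_norm (X - dyad_sum (fun i => Num.max (s i - lambda) 0) U V) ^+ 2
    <= svt_objective lambda Y X.
Proof.
move=> le_mn l0 [U1 V1 s0 s_dec YE]; set X0 := dyad_sum _ _ _.
have max0 x : 0 <= Num.max x 0 :> R by rewrite le_max lexx orbT.
(* Since [s i - max(s i - lambda, 0) = min(s i, lambda)], these are the coefficients of [Y - X0]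
   divided by [lambda]. *)
pose w i := Num.min (s i / lambda) 1; pose W := dyad_sum w U V.
have w01 i : 0 <= w i <= 1.
  by rewrite /w le_min ge_min lexx ler01 orbT !andbT divr_ge0 // ltW.
have YX0 : Y - X0 = lambda *: W.
  rewrite YE dyad_sumB dyad_sumZ; apply: eq_dyad_sum => i.
  rewrite /w minr_pMr ?ltW // mulr1 mulrC divfK ?gt_eqF //.
  by rewrite /Num.max /Num.min; do 2!case: ifP; lra.
(* Wherever the thresholded value is nonzero, [s i] exceeds [lambda] and hence [w i = 1]. *)
have X0_nuc : nuclear_norm X0 = \tr (W^T *m X0).
  rewrite mxtrace_dyad_sum2 // (@nuclear_normE _ _ _ _ (fun i => Num.max (s i - lambda) 0)).
    apply: eq_bigr => i _; rewrite /w /Num.max /Num.min ltr_pdivrMr // mul1r.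
    by do 2!case: ifP; rewrite ?mul0r ?mulr1 //; lra.
  exists U, V; split => // i j le_ij.
  by rewrite ge_max max0 andbT le_max lerB // s_dec.
have X_nuc : \tr (W^T *m X) <= nuclear_norm X.
  have [r Xr] := svd_exists X le_mn; rewrite (nuclear_normE Xr).
  by case: Xr => U' [V' [U'1 V'1 r0 _ ->]]; exact: trace_duality.
rewrite /svt_objective -/X0 !frobenius_norm_sqr.
have XYE : X - Y = (X - X0) - lambda *: W by rewrite -YX0 opprB addrA subrK.
have X0YE : X0 - Y = - (lambda *: W) by rewrite -YX0 opprB.
rewrite XYE X0YE (mxtrace_sqrD (X - X0)) X0_nuc.
rewrite (mxtrace_mulC_tr (X - X0) (- _)).
have -> : \tr ((- (lambda *: W))^T *m (X - X0)) =
    - lambda * (\tr (W^T *m X) - \tr (W^T *m X0)).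
  by rewrite -scaleNr [(_ *: _)^T]linearZ /= -scalemxAl linearZ /= mulmxBr raddfB.
move: X_nuc; set a := \tr (W^T *m X); set b := \tr (W^T *m X0); set N := nuclear_norm X.
set c := \tr ((X - X0)^T *m _); set d := \tr _ => aN.
(* The cross term becomes [- (a - b)], and [b] is the nuclear norm of [X0], so the claim reduces to
   [a <= N]. *)
have -> : (2 * lambda)^-1 * (c + 2 * (- lambda * (a - b)) + d) =
    (2 * lambda)^-1 * c + (2 * lambda)^-1 * d - (a - b).
  by field; rewrite gt_eqF.
lra.
Qed.

Lemma frobenius_norm_sqr_eq0 (R : realType) (m n : nat) (A : 'M[R]_(m, n)) :
  (frobenius_norm A ^+ 2 == 0) = (A == 0).
Proof. by rewrite frobenius_norm_sqr mxtrace_sqr_eq0. Qed.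

(** The quadratic gap in [svt_objective_ge] is nonnegative, so the thresholded matrix is a
    minimizer; at any other minimizer the gap must vanish. *)
Lemma svt_minimizerP (R : realType) (m n : nat) (lambda : R) (Y X : 'M[R]_(m, n))
    (s : 'I_m -> R) (U : 'M[R]_m) (V : 'M[R]_(n, m)) :
  (m <= n)%N -> 0 < lambda -> is_svd Y s U V ->
  is_minimizer (svt_objective lambda Y) X <->
  X = dyad_sum (fun i => Num.max (s i - lambda) 0) U V.
Proof.
move=> le_mn l0 Ysvd; set X0 := dyad_sum _ _ _.
have ge Z := @svt_objective_ge _ _ _ _ _ Z _ _ _ le_mn l0 Ysvd; rewrite -/X0 /= in ge.
have l2 : 0 < (2 * lambda)^-1 by rewrite invr_gt0 mulr_gt0.
split=> [Xmin|-> Z]; last first.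
  by apply: le_trans (ge Z); rewrite lerDl mulr_ge0 ?sqr_ge0 // ltW.
have := le_trans (ge X) (Xmin X0); rewrite gerDl pmulr_rle0 // => le0.
by apply/eqP; rewrite -subr_eq0 -frobenius_norm_sqr_eq0 eq_le le0 sqr_ge0.
Qed.

(** The matrix chosen by [xget] may come from a different decomposition. For [lambda > 0] both
    thresholdings are the unique minimizer of one objective; for [lambda = 0] both give back [Y]. *)
Lemma SVT_eq_dyad_sum (R : realType) (m n : nat) (lambda : R) (Y : 'M[R]_(m, n))
    (s : 'I_m -> R) (U : 'M[R]_m) (V : 'M[R]_(n, m)) :
  (m <= n)%N -> 0 <= lambda -> is_svd Y s U V ->
  SVT lambda Y = dyad_sum (fun i => Num.max (s i - lambda) 0) U V.
Proof.
move=> le_mn l0 Ysvd; rewrite /SVT; case: xgetP => [X _|none]; last first.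
  by case: (none (dyad_sum (fun i => Num.max (s i - lambda) 0) U V)); exists s, U, V.
case=> r [U' [V' [Ysvd' ->]]].
move: l0; rewrite le_eqVlt => /predU1P[<-|l0]; last first.
  by apply/(svt_minimizerP _ le_mn l0 Ysvd)/(svt_minimizerP _ le_mn l0 Ysvd').
have id0 r' U1 V1 : is_svd Y r' U1 V1 -> dyad_sum (fun i => Num.max (r' i - 0) 0) U1 V1 = Y.
  by case=> _ _ r0 _ ->; apply: eq_dyad_sum => i; rewrite subr0 max_l.
by rewrite !id0.
Qed.

(** * Monotonicity and positivity of the residual *)

Theorem theorem4p1 (R : realType) (m n : nat) (m_gt0 : (0 < m)%N)
    (le_mn : (m <= n)%N) (Y : 'M[R]_(m, n)) (sigma : 'I_m -> R)
    (Ysigma : singular_values Y sigma) :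
  let sigma1 := sigma (Ordinal m_gt0) in
  let residual := fun lambda : R => frobenius_norm (Y - SVT lambda Y) ^+ 2 in
  [/\ forall lambda : R, 0 < lambda -> forall X : 'M[R]_(m, n),
        is_minimizer (svt_objective lambda Y) X <-> X = SVT lambda Y,
      {in `[0, sigma1] &, {homo residual : x y / x < y}}
    & {in `]0, sigma1], forall lambda : R, 0 < residual lambda}].
Proof.
move=> sigma1 residual; have [U [V Ysvd]] := Ysigma.
have [U1 V1 sigma_ge0 _ YE] := Ysvd.
have residualE l : 0 <= l -> residual l = \sum_i Num.min (sigma i) l ^+ 2.
  move=> l0; rewrite /residual frobenius_norm_sqr (SVT_eq_dyad_sum le_mn l0 Ysvd) {1 2}YE.
  rewrite dyad_sumB mxtrace_dyad_sum2 //; apply: eq_bigr => i _; rewrite -expr2.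
  by congr (_ ^+ 2); rewrite /Num.max /Num.min; do 2!case: ifP; lra.
have incr : {in `[0, sigma1] &, {homo residual : x y / x < y}}.
  move=> x y; rewrite !in_itv /= => /andP[x0 xs] /andP[y0 ys] xy; rewrite !residualE //.
  (* On [[0, sigma1]] the first term is the square of the parameter itself, which gives strictness;
     the other terms are only weakly increasing. *)
  rewrite (bigD1 (Ordinal m_gt0)) // [X in _ < X](bigD1 (Ordinal m_gt0)) //=.
  apply: ltr_leD; first by rewrite !min_r // ltrXn2r.
  apply: ler_sum => i _; rewrite lerXn2r ?nnegrE ?le_min ?sigma_ge0 //.
  by rewrite !ge_min lexx (ltW xy) orbT.
split=> [l l0 X|//|l].
  by rewrite (SVT_eq_dyad_sum le_mn (ltW l0) Ysvd); exact: svt_minimizerP.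
rewrite in_itv /= => /andP[l0 ls].
(* Positivity follows by comparison with [residual 0], which is nonnegative as a square. *)
have : residual 0 < residual l.
  by apply: incr => //; rewrite in_itv /= ?lexx ?(ltW l0) ?ls ?sigma_ge0.
by apply: le_lt_trans; exact: sqr_ge0.
Qed.
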